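(* Let $r\ge 1$ and let $\tau$ be a bijection from $F^r$ to $F^r$ such that $\tau({\bf 0})={\bf 0}$ and the deficiency of $\tau$ is $r$. Then the code $S_{\mathcal H,\tau}=\bigcup_{a\in F^r}\mathcal H_a\times\mathcal H_{\tau(a)}$ is not equivalent to any extended perfect Mollard code, and the code $S'_{\mathcal H,\tau}=\bigcup_{a\in F^r}\mathcal H'_a\times\mathcal H_{\tau(a)}$ is not equivalent to any perfect Mollard code.
   Context: $F=\mathrm{GF}(2)$; a code of length $n$ is a set of vectors of $F^n$. $\mathrm{wt}$ is Hamming weight. ${\bf 0}$ denotes the all-zero vector. A code $C\subseteq F^n$ is perfect if for every $x\in F^n$ there is exactly one $y\in C$ at Hamming distance at most $1$ from $x$. Extending a code means adding an overall parity check coordinate to all its codewords. Two codes of length $n$ are equivalent if some transformation $y\mapsto x+\pi(y)$, with $x\in F^n$ and $\pi$ a permutation of the coordinate positions, maps one onto the other. The coordinates of $F^{2^r}$ are indexed by the vectors of $F^r$, and those of $F^{2^r-1}$ by the nonzero vectors of $F^r$; $e_a$ is the vector (in either space) whose only nonzero coordinate is the one indexed by $a$. $\mathcal H=\{c\in F^{2^r}:\sum_{a:c_a=1}a={\bf 0},\ \mathrm{wt}(c)\equiv 0 \pmod 2\}$, $\mathcal H_a=\mathcal H+e_a+e_{\bf 0}$ for $a\in F^r$; $\mathcal H'=\{c\in F^{2^r-1}:\sum_{a:c_a=1}a={\bf 0}\}$, $\mathcal H'_a=e_a+\mathcal H'$ for $a\neq{\bf 0}$, $\mathcal H'_{\bf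 0}=\mathcal H'$. For codes $C,D$, $C\times D=\{x|y: x\in C,\ y\in D\}$, where $x|y$ is concatenation. For nonzero $a\in F^r$, $\mathrm{Star}(a)=\{\{a,b,a+b\}: b\in F^r\setminus\{{\bf 0},a\}\}$, and $\tau(\mathrm{Star}(a))=\{\{\tau(a),\tau(b),\tau(a+b)\}: b\in F^r\setminus\{{\bf 0},a\}\}$. The number of nonzero $a$ with $\tau(\mathrm{Star}(a))=\mathrm{Star}(\tau(a))$ is always a power of two minus one, and the deficiency of $\tau$ is $r-\log_2\left(|\{a\in F^r\setminus\{{\bf 0}\}:\tau(\mathrm{Star}(a))=\mathrm{Star}(\tau(a))\}|+1\right)$. Mollard codes: let $C$ and $D$ be perfect codes of lengths $t$ and $m$ respectively, both containing the all-zero vector, and let $f:C\to F^m$ be any function. Index the coordinates of $F^{tm}$ by pairs $(i,j)$, $1\le i\le t$, $1\le j\le m$. Define $p_1:F^{tm}\to F^t$ and $p_2:F^{tm}\to F^m$ by $(p_1(x))_i=\sum_{j=1}^m x_{(i,j)}$, $(p_2(x))_j=\sum_{i=1}^t x_{(i,j)}$. Let $Z=\{(x|p_1(x)|p_2(x)):x\in F^{tm}\}$. The (perfect) Mollard code of length $tm+t+m$ is $M(C,D)=\{({\bf 0}|y|z+f(y)): y\in C,\ z\in D\}+Z$. An extended perfect Mollard code is the extension of such a code by an overall parity check. *)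

(* Defs.v *)
From mathcomp Require Import all_boot all_algebra.

Set Implicit Arguments.
Unset Strict Implicit.
Unset Printing Implicit Defensive.

Import GRing.Theory.
Local Open Scope ring_scope.

(* Binary words are indexed by an arbitrary finite type of coordinates, so   *)
(* F^n is [word 'I_n], F^(2^r) is [word (word 'I_r)], and concatenation uses *)
(* the disjoint sum of the coordinate types.                                 *)
Notation word I := {ffun I%type -> 'F_2}.

Definition wt (I : finType) (x : word I) : nat := #|[set i | x i != 0]|.

Definition dH (I : finType) (x y : word I) : nat := wt (x - y).

Definition basis_word (I : finType) (a : I) : word I :=
  [ffun b => if b == a then 1 else 0].

Definition perfect (I : finType) (C : {set word I}) : Prop :=
  forall x : word I, exists! y : word I, y \in C /\ (dH x y <= 1)%N.

Definition extend_word (I : finType) (x : word I) : word (option I) :=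
  [ffun k => if k is Some i then x i else \sum_(i : I) x i].

Definition extend (I : finType) (C : {set word I}) : {set word (option I)} :=
  [set extend_word x | x in C].

(* The coordinate types of the two codes may differ, hence a bijection       *)
(* between them plays the role of the coordinate permutation: [s] sends a    *)
(* position of the image to the position of the source it is read from.      *)
Definition equivalent (I J : finType) (C : {set word I}) (D : {set word J})
    : Prop :=
  exists (x : word J) (s : J -> I),
    bijective s /\ D = [set x + [ffun j => y (s j)] | y : word I in C].

Definition concat (I J : finType) (x : word I) (y : word J) : word (I + J) :=
  [ffun k => match k with inl i => x i | inr j => y j end].

Definition code_prod (I J : finType) (C : {set word I}) (D : {set word J})
    : {set word (I + J)} :=
  [set concat x y | x in C, y in D].

Notation nonzero r := {a : word 'I_r | a != 0}.

Definition ext_hamming (r : nat) : {set word (word 'I_r)} :=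
  [set c : word (word 'I_r) | (\sum_(a | c a == 1) a == 0) && ~~ odd (wt c)].

Definition ext_hamming_at (r : nat) (a : word 'I_r) : {set word (word 'I_r)} :=
  [set c + basis_word a + basis_word (0 : word 'I_r)
     | c : word (word 'I_r) in ext_hamming r].

Definition hamming (r : nat) : {set word (nonzero r)} :=
  [set c : word (nonzero r) | \sum_(a | c a == 1) val a == 0].

(* [insub a] is [Some a'] with [val a' = a] if [a != 0], and [None] if       *)
(* [a = 0].                                                                  *)
Definition hamming_at (r : nat) (a : word 'I_r) : {set word (nonzero r)} :=
  if insub a is Some a' then
    [set basis_word a' + c | c : word (nonzero r) in hamming r]
  else hamming r.

Definition ext_soloveva (r : nat) (tau : word 'I_r -> word 'I_r)
    : {set word (word 'I_r + word 'I_r)} :=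
  \bigcup_(a : word 'I_r) code_prod (ext_hamming_at a) (ext_hamming_at (tau a)).

Definition soloveva (r : nat) (tau : word 'I_r -> word 'I_r)
    : {set word (nonzero r + word 'I_r)} :=
  \bigcup_(a : word 'I_r) code_prod (hamming_at a) (ext_hamming_at (tau a)).

Definition star (r : nat) (a : word 'I_r) : {set {set word 'I_r}} :=
  [set [set a; b; a + b] | b : word 'I_r in ~: [set (0 : word 'I_r); a]].

Definition star_image (r : nat) (tau : word 'I_r -> word 'I_r) (a : word 'I_r)
    : {set {set word 'I_r}} :=
  [set [set tau a; tau b; tau (a + b)]
     | b : word 'I_r in ~: [set (0 : word 'I_r); a]].

Definition preserved_stars (r : nat) (tau : word 'I_r -> word 'I_r)
    : {set word 'I_r} :=
  [set a : word 'I_r | (a != 0) && (star_image tau a == star (tau a))].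

(* For a bijection fixing 0, the preserved points together with 0 form a     *)
(* subspace, so the argument of the logarithm is a power of two not          *)
(* exceeding 2 ^ r: neither [trunc_log] nor the subtraction truncates.       *)
Definition deficiency (r : nat) (tau : word 'I_r -> word 'I_r) : nat :=
  (r - trunc_log 2 (#|preserved_stars tau| + 1))%N.

Definition mollard_p1 (t m : nat) (x : word ('I_t * 'I_m)) : word 'I_t :=
  [ffun i => \sum_(j < m) x (i, j)].

Definition mollard_p2 (t m : nat) (x : word ('I_t * 'I_m)) : word 'I_m :=
  [ffun j => \sum_(i < t) x (i, j)].

Definition mollard_Z (t m : nat)
    : {set word ('I_t * 'I_m + ('I_t + 'I_m))} :=
  [set concat x (concat (mollard_p1 x) (mollard_p2 x))
     | x : word ('I_t * 'I_m)].

(* Only the values of [f] on [C] matter. *)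
Definition mollard (t m : nat) (C : {set word 'I_t}) (D : {set word 'I_m})
    (f : word 'I_t -> word 'I_m) : {set word ('I_t * 'I_m + ('I_t + 'I_m))} :=
  [set w + u
     | w : word ('I_t * 'I_m + ('I_t + 'I_m))
         in [set concat (0 : word ('I_t * 'I_m)) (concat y (z + f y))
               | y : word 'I_t in C, z : word 'I_m in D],
       u : word ('I_t * 'I_m + ('I_t + 'I_m)) in mollard_Z t m].

(* Main.v *)
Require Import Defs.
From mathcomp Require Import all_boot all_algebra.

Import GRing.Theory.
Local Open Scope ring_scope.

(** A translation preserving an equivalent copy of a code is, up to a
coordinate permutation, a translation preserving the code. When no star is
preserved, [tau (a + b) = tau a + tau b] for all [a] forces [b = 0], so every
period of the Soloveva code is a pair of words of which the one indexed by all
of F^r (both of them, in the extended case) lies in the extended Hamming code,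
which has minimum distance 4. A Mollard code has the periods
[e_(i,j) + e_i + e_j], of weight 3, which cover all positions; each vanishes
on the half indexed by F^r, a contradiction. After extension they gain the
parity position and weight 4, so each is supported on the half containing
that position, although together they cover both halves. *)

Definition period {I : finType} (C : {set word I}) (k : word I) : Prop :=
  forall y, y \in C -> y + k \in C.

(** * Binary words: addition, concatenation, weight *)

Lemma F2_cases (x : 'F_2) : x = 0 \/ x = 1.
Proof. by case: x => [[|[|n]] h]; [left|right|]; try apply: val_inj. Qed.

Lemma addF2 (x : 'F_2) : x + x = 0.
Proof. by case: (F2_cases x) => ->; apply: val_inj. Qed.

Lemma add_wordxx {I : finType} (x : word I) : x + x = 0.
Proof. by apply/ffunP => i; rewrite !ffunE addF2. Qed.

Lemma add_wordK {I : finType} (x y : word I) : x + y + y = x.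
Proof. by rewrite -addrA add_wordxx addr0. Qed.

Lemma add_word_eq0 {I : finType} (x y : word I) : x + y = 0 -> x = y.
Proof. by move=> xy; rewrite -[x](add_wordK x y) xy add0r. Qed.

Lemma basis_word_id {I : finType} (a : I) : basis_word a a = 1.
Proof. by rewrite ffunE eqxx. Qed.

Lemma concatD {I J : finType} (x x' : word I) (y y' : word J) :
  concat x y + concat x' y' = concat (x + x') (y + y').
Proof. by apply/ffunP => -[i|j]; rewrite !ffunE. Qed.

Lemma concat0 (I J : finType) : concat (0 : word I) (0 : word J) = 0.
Proof. by apply/ffunP => -[i|j]; rewrite !ffunE. Qed.

Lemma concatK {I J : finType} (k : word (I + J)) :
  concat [ffun i => k (inl i)] [ffun j => k (inr j)] = k.
Proof. by apply/ffunP => -[i|j]; rewrite !ffunE. Qed.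

Lemma concat_inj {I J : finType} (x x' : word I) (y y' : word J) :
  concat x y = concat x' y' -> x = x' /\ y = y'.
Proof.
move=> /ffunP h; split; apply/ffunP => i.
  by have := h (inl i); rewrite !ffunE.
by have := h (inr i); rewrite !ffunE.
Qed.

Lemma mem_code_prod {I J : finType} (C : {set word I}) (D : {set word J}) x y :
  (concat x y \in code_prod C D) = (x \in C) && (y \in D).
Proof.
apply/imset2P/andP => [[x' y' Cx' Dy' /concat_inj [-> ->]] //|[Cx Dy]].
by exists x y.
Qed.

Lemma wtE {I : finType} (x : word I) : wt x = (\sum_i (x i != 0)%R)%N.
Proof.
by rewrite /wt -sum1dep_card big_mkcond; apply: eq_bigr => i _; case: eqP.
Qed.

Lemma wt_concat {I J : finType} (x : word I) (y : word J) :
  wt (concat x y) = (wt x + wt y)%N.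
Proof.
by rewrite !wtE big_sumType; congr addn; apply: eq_bigr => i _; rewrite ffunE.
Qed.

Lemma wt0 (I : finType) : wt (0 : word I) = 0%N.
Proof. by rewrite wtE big1 // => i _; rewrite ffunE eqxx. Qed.

Lemma wt_comp {I J : finType} (s : J -> I) (x : word I) :
  bijective s -> wt [ffun j => x (s j)] = wt x.
Proof.
move=> s_bij; rewrite !wtE [RHS](reindex s); last exact: onW_bij.
by apply: eq_bigr => j _; rewrite ffunE.
Qed.

Lemma wt_basis_word {I : finType} (a : I) : wt (basis_word a) = 1%N.
Proof.
rewrite wtE (bigD1 a) //= basis_word_id big1 ?oner_eq0 // => i /negbTE ia.
by rewrite ffunE ia eqxx.
Qed.

Lemma odd_wtD {I : finType} (x y : word I) :
  odd (wt (x + y)) = odd (wt x) (+) odd (wt y).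
Proof.
rewrite -oddD !wtE -big_split /=.
elim/big_rec2: _ => // i m n _ mn; rewrite oddD mn oddD ffunE.
by case: (F2_cases (x i)) => ->; case: (F2_cases (y i)) => ->.
Qed.

(** * Syndromes and membership in the codes *)

(** The Hamming syndrome, with [h] giving the columns of the parity-check matrix: [id] for the
    extended code, [val] for the code on nonzero positions. *)
Definition synd {I : finType} {r} (h : I -> word 'I_r) (c : word I) :=
  \sum_(i | c i == 1) h i.

Lemma syndD {I : finType} {r} (h : I -> word 'I_r) x y :
  synd h (x + y) = synd h x + synd h y.
Proof.
rewrite /synd !(big_mkcond (fun i => _ == 1)) -big_split /=.
apply: eq_bigr => i _; rewrite ffunE.
case: (F2_cases (x i)) => ->; case: (F2_cases (y i)) => -> /=.
- by rewrite addr0.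
- by rewrite !add0r.
- by rewrite !addr0.
- by rewrite add_wordxx.
Qed.

Lemma synd0 {I : finType} {r} (h : I -> word 'I_r) : synd h 0 = 0.
Proof. by apply: (addrI (synd h 0)); rewrite -syndD !addr0. Qed.

Lemma synd_basis_word {I : finType} {r} (h : I -> word 'I_r) a :
  synd h (basis_word a) = h a.
Proof.
rewrite /synd (big_pred1 a) // => i; rewrite ffunE.
by rewrite /=; case: (i == a).
Qed.

Lemma mem_ext_hamming {r} (c : word (word 'I_r)) :
  (c \in ext_hamming r) = (synd id c == 0) && ~~ odd (wt c).
Proof. by rewrite inE. Qed.

Lemma mem_ext_hamming_at {r} (a : word 'I_r) c :
  (c \in ext_hamming_at a) = (synd id c == a) && ~~ odd (wt c).
Proof.
apply/imsetP/andP => [[d]|[/eqP ca cev]].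
  rewrite mem_ext_hamming => /andP [/eqP d0 dev] ->.
  by rewrite !syndD !odd_wtD !synd_basis_word !wt_basis_word d0 add0r addr0
    (negbTE dev) eqxx.
exists (c + basis_word a + basis_word (0 : word 'I_r)).
  by rewrite mem_ext_hamming !syndD !odd_wtD !synd_basis_word !wt_basis_word ca
    add_wordxx addr0 (negbTE cev) eqxx.
by rewrite addrAC !add_wordK.
Qed.

Lemma mem_hamming_at {r} (a : word 'I_r) c :
  (c \in hamming_at a) = (synd val c == a).
Proof.
rewrite /hamming_at; case: insubP => [a' _ a'a | /negPn/eqP ->].
  2: by rewrite inE.
apply/imsetP/eqP => [[d]|ca].
  by rewrite inE => /eqP d0 ->; rewrite syndD synd_basis_word a'a /synd d0 addr0.
exists (basis_word a' + c); last by rewrite addrA add_wordxx add0r.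
by rewrite inE -/(synd _ _) syndD synd_basis_word ca a'a add_wordxx.
Qed.

(** The syndrome of [u] is the only possible index [a], so the union collapses to one equation
    between syndromes plus parity conditions. *)
Lemma mem_ext_soloveva {r} {tau : word 'I_r -> word 'I_r} u v :
  (concat u v \in ext_soloveva tau) =
  [&& ~~ odd (wt u), ~~ odd (wt v) & synd id v == tau (synd id u)].
Proof.
apply/bigcupP/and3P => [[a _]|[uev vev /eqP vu]].
  rewrite mem_code_prod !mem_ext_hamming_at.
  by move=> /andP [/andP [/eqP -> ->] /andP [/eqP -> ->]].
exists (synd id u); rewrite // mem_code_prod !mem_ext_hamming_at.
by rewrite uev vev vu !eqxx.
Qed.

Lemma mem_soloveva {r} {tau : word 'I_r -> word 'I_r} u v :
  (concat u v \in soloveva tau) =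
  ~~ odd (wt v) && (synd id v == tau (synd val u)).
Proof.
apply/bigcupP/andP => [[a _]|[vev /eqP vu]].
  rewrite mem_code_prod mem_hamming_at mem_ext_hamming_at.
  by move=> /andP [/eqP -> /andP [/eqP -> ->]].
by exists (synd val u); rewrite // mem_code_prod mem_hamming_at mem_ext_hamming_at
  vev vu !eqxx.
Qed.

(** Even parity leaves only weight 2 to exclude, and there the syndrome is the sum of two distinct
    positions, hence nonzero. *)
Lemma ext_hamming_wt_ge4 {r} {c : word (word 'I_r)} :
  c \in ext_hamming r -> c != 0 -> (4 <= wt c)%N.
Proof.
rewrite mem_ext_hamming => /andP [/eqP c0 cev] cN0.
have wt0 : wt c != 0%N.
  apply: contra cN0; rewrite cards_eq0 => /eqP/setP h.
  by apply/eqP/ffunP => i; have := h i; rewrite !inE ffunE => /negbFE/eqP.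
have wt2 : wt c != 2%N.
  apply/negP => /cards2P [a [b [ab /setP h]]].
  have : synd id c = a + b.
    rewrite /synd (eq_bigl (fun i => i \in [set a; b])).
      by rewrite big_setU1 ?inE //= big_set1.
    by move=> i; rewrite -h inE; case: (F2_cases (c i)) => ->.
  by rewrite c0 => /esym/add_word_eq0 /eqP; rewrite (negbTE ab).
by move: (wt c) cev wt0 wt2 => [|[|[|[|n]]]].
Qed.

(** * Preserved stars and deficiency *)

(** Additivity at [al] sends each triple of its star into the star of [tau al]; the inverse [g]
    shows that every triple there is reached. *)
Lemma star_preserved {r} {tau : word 'I_r -> word 'I_r} {al} :
    bijective tau -> tau 0 = 0 -> al != 0 ->
    (forall a, tau (al + a) = tau al + tau a) ->
  al \in preserved_stars tau.
Proof.
move=> [g tauK gK] tau0 al0 tauD; rewrite inE al0 /=; apply/eqP/setP => T.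
have tau_inj := can_inj tauK.
apply/imsetP/imsetP => -[b]; rewrite !inE negb_or => /andP [b0 bal] ->.
  exists (tau b); last by rewrite tauD.
  by rewrite !inE negb_or -{1}tau0 !(inj_eq tau_inj) b0.
exists (g b); last by rewrite tauD gK.
by rewrite !inE negb_or -(inj_eq tau_inj _ 0) -(inj_eq tau_inj _ al) gK tau0 b0.
Qed.

(** For positive [r], truncated subtraction returns [r] only if the logarithm is 0, that is, if its
    argument is below 2. *)
Lemma deficiency_full {r} {tau : word 'I_r -> word 'I_r} :
  (0 < r)%N -> deficiency tau = r -> preserved_stars tau = set0.
Proof.
move=> r_gt0 def; apply/eqP; rewrite -cards_eq0 -leqn0 leqNgt; apply/negP => lt0.
have : (0 < trunc_log 2 (#|preserved_stars tau| + 1))%N.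
  by rewrite trunc_log_gt0 addn1 !ltnS.
by move=> log_gt0; have := ltnn r; rewrite -{1}def ltn_subrL log_gt0 r_gt0.
Qed.

(** * Periods of the Soloveva codes *)

Section Periods.
Context {r : nat} {tau : word 'I_r -> word 'I_r}.
Hypotheses (tau_bij : bijective tau) (tau0 : tau 0 = 0).
Hypothesis no_star : preserved_stars tau = set0.

(** Putting [a = 0] gives [be = tau al], so [tau] is additive at [al]; a nonzero [al] would then
    have a preserved star. *)
Lemma translation_trivial {al be} :
  (forall a, tau (a + al) = tau a + be) -> al = 0 /\ be = 0.
Proof.
move=> h; have be_def : be = tau al by rewrite -[al]add0r h tau0 add0r.
have al0 : al = 0.
  apply/eqP; apply: contraT => al0.
  have : al \in preserved_stars tau.
    by apply: star_preserved => // a; rewrite addrC h be_def addrC.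
  by rewrite no_star inE.
by rewrite be_def al0 tau0.
Qed.

(** Shifting the zero word gives the parities of [k] and [l]; shifting codewords of every left
    syndrome [a] makes their syndromes a translation identity for [tau]. *)
Lemma period_ext_soloveva {k l} : period (ext_soloveva tau) (concat k l) ->
  k \in ext_hamming r /\ l \in ext_hamming r.
Proof.
move=> per; have := per 0; rewrite add0r -concat0 !mem_ext_soloveva !synd0 tau0.
rewrite !wt0 eqxx => /(_ isT) /and3P [kev lev _].
suff /translation_trivial [k0 l0] a :
    tau (a + synd id k) = tau a + synd id l.
  by rewrite !mem_ext_hamming k0 l0 kev lev eqxx.
(* Position 0 adds nothing to a syndrome and serves to make the weight even. *)
have /per : concat (basis_word a + basis_word (0 : word 'I_r))
    (basis_word (tau a) + basis_word (0 : word 'I_r)) \in ext_soloveva tau.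
  by rewrite mem_ext_soloveva !syndD !odd_wtD !synd_basis_word !wt_basis_word
    !addr0 eqxx.
by rewrite concatD mem_ext_soloveva !syndD !synd_basis_word !addr0
  => /and3P [_ _ /eqP ->].
Qed.

(** The left half carries no parity condition, so the bound of 4 on weights is available for [l]
    only. *)
Lemma period_soloveva {k l} : period (soloveva tau) (concat k l) ->
  l \in ext_hamming r.
Proof.
move=> per; have := per 0; rewrite add0r -concat0 !mem_soloveva !synd0 tau0.
rewrite !wt0 eqxx => /(_ isT) /andP [lev _].
suff /translation_trivial [k0 l0] a :
    tau (a + synd val k) = tau a + synd id l.
  by rewrite mem_ext_hamming l0 lev eqxx.
have [u ua] : exists u : word (nonzero r), synd val u = a.
  have [->|a0] := eqVneq a 0; first by exists 0; rewrite synd0.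
  by exists (basis_word (exist _ a a0)); rewrite synd_basis_word.
have /per : concat u (basis_word (tau a) + basis_word (0 : word 'I_r))
    \in soloveva tau.
  by rewrite mem_soloveva !syndD !odd_wtD !synd_basis_word !wt_basis_word
    ua addr0 eqxx.
by rewrite concatD mem_soloveva !syndD !synd_basis_word addr0 ua
  => /andP [_ /eqP ->].
Qed.
End Periods.

(** * Periods under equivalence and extension *)

(** The translation [x] cancels, so only the coordinate permutation acts on periods. *)
Lemma period_equivalent {I J : finType} {C : {set word I}} {x}
    {s : J -> I} {s' k} :
    cancel s s' -> cancel s' s ->
    period [set x + [ffun j => y (s j)] | y : word I in C] k ->
  period C [ffun i => k (s' i)].
Proof.
move=> sK s'K per y Cy.
have /per /imsetP [z Cz /ffunP e] :=
  imset_f (fun y : word I => x + [ffun j => y (s j)]) Cy.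
suff -> : y + [ffun i => k (s' i)] = z by [].
apply/ffunP => i; have := e (s' i); rewrite !ffunE s'K -addrA; exact: addrI.
Qed.

Lemma extend_wordD {I : finType} (x y : word I) :
  extend_word (x + y) = extend_word x + extend_word y.
Proof.
apply/ffunP => -[i|]; rewrite !ffunE // -big_split /=.
by apply: eq_bigr => i _; rewrite ffunE.
Qed.

Lemma period_extend {I : finType} (C : {set word I}) k :
  period C k -> period (extend C) (extend_word k).
Proof.
move=> per _ /imsetP [y Cy ->]; rewrite -extend_wordD.
exact/imset_f/per.
Qed.

(** * Light periods of Mollard codes *)

Section Mollard.
Context {t m : nat}.

Definition mollard_period (p : 'I_t * 'I_m) :
    word ('I_t * 'I_m + ('I_t + 'I_m)) :=
  concat (basis_word p) (concat (basis_word p.1) (basis_word p.2)).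

(** The word is the element of [mollard_Z] generated by [basis_word p], and [mollard_Z] is closed
    under addition. *)
Lemma mollard_periodP (C : {set word 'I_t}) (D : {set word 'I_m}) f p :
  period (mollard C D f) (mollard_period p).
Proof.
move=> _ /imset2P [w _ Cw /imsetP [x _ ->] ->]; rewrite -addrA.
apply: imset2_f => //; apply/imsetP; exists (x + basis_word p) => //.
case: p => i j; rewrite /mollard_period !concatD.
congr (concat _ (concat _ _)); apply/ffunP => q; rewrite !ffunE.
  under [RHS]eq_bigr do rewrite ffunE.
  rewrite big_split /=; congr (_ + _).
  rewrite (bigD1 j) //= big1 => [|j' /negbTE jj']; rewrite ffunE xpair_eqE.
    by rewrite eqxx andbT addr0.
  by rewrite jj' andbF.
under [RHS]eq_bigr do rewrite ffunE.
rewrite big_split /=; congr (_ + _).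
rewrite (bigD1 i) //= big1 => [|i' /negbTE ii']; rewrite ffunE xpair_eqE.
  by rewrite eqxx addr0.
by rewrite ii'.
Qed.

Lemma wt_mollard_period p : wt (mollard_period p) = 3.
Proof. by rewrite !wt_concat !wt_basis_word. Qed.

Lemma mollard_period_cover (q : 'I_t * 'I_m + ('I_t + 'I_m)) :
  (0 < t)%N -> (0 < m)%N -> exists p, mollard_period p q = 1.
Proof.
move=> t0 m0; case: q => [p|[i|j]].
- by exists p; rewrite ffunE basis_word_id.
- by exists (i, Ordinal m0); rewrite !ffunE eqxx.
- by exists (Ordinal t0, j); rewrite !ffunE eqxx.
Qed.
End Mollard.

(** * Weight and the parity coordinate *)

Lemma sum_word {I : finType} (x : word I) : \sum_i x i = (odd (wt x))%:R.
Proof.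
rewrite wtE; elim/big_rec2: _ => // i n a _ ->.
rewrite oddD; case: (F2_cases (x i)) => -> /=; first by rewrite add0r.
by case: (odd a); apply: val_inj.
Qed.

Lemma wt_extend_word {I : finType} (x : word I) :
  wt (extend_word x) = (odd (wt x) + wt x)%N.
Proof.
rewrite wtE (bigD1 None) //= ffunE sum_word; congr addn; first by case: odd.
rewrite wtE (reindex_omap Some id) //=; last by case.
rewrite (eq_bigl xpredT) => [|i]; last by rewrite eqxx.
by apply: eq_bigr => i _; rewrite ffunE.
Qed.

Theorem theorem2 (r : nat) (tau : word 'I_r -> word 'I_r)
    (r_ge1 : (1 <= r)%N)
    (tau_bij : bijective tau)
    (tau0 : tau 0 = 0)
    (tau_def : deficiency tau = r) :
  (forall (t m : nat) (C : {set word 'I_t}) (D : {set word 'I_m})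
      (f : word 'I_t -> word 'I_m),
    (1 <= t)%N -> (1 <= m)%N ->
    perfect C -> perfect D -> 0 \in C -> 0 \in D ->
    ~ equivalent (ext_soloveva tau) (extend (mollard C D f))) /\
  (forall (t m : nat) (C : {set word 'I_t}) (D : {set word 'I_m})
      (f : word 'I_t -> word 'I_m),
    (1 <= t)%N -> (1 <= m)%N ->
    perfect C -> perfect D -> 0 \in C -> 0 \in D ->
    ~ equivalent (soloveva tau) (mollard C D f)).
Proof.
have no_star := deficiency_full r_ge1 tau_def.
split=> t m C D f t0 m0 _ _ _ _ [x [s [[s' sK s'K] eqC]]].
  (* Two nonzero halves would each weigh at least 4, giving total weight at least 8. *)
  have light (k : word (option _)) : period (extend (mollard C D f)) k ->
      (wt k <= 4)%N ->
      (forall a, k (s' (inl a)) = 0) \/ (forall b, k (s' (inr b)) = 0).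
    rewrite eqC => /(period_equivalent sK s'K) + k4.
    rewrite -[X in period _ X]concatK.
    move=> /(period_ext_soloveva tau_bij tau0 no_star) [].
    set k1 := [ffun i => _]; set k2 := [ffun j => _] => Hk1 Hk2.
    have wtk : (wt k1 + wt k2 <= 4)%N.
      by rewrite -wt_concat concatK wt_comp //; exists s.
    have [k10|k1N] := eqVneq k1 0.
      by left=> a; move/ffunP/(_ a): k10; rewrite !ffunE.
    have [k20|k2N] := eqVneq k2 0.
      by right=> b; move/ffunP/(_ b): k20; rewrite !ffunE.
    have := leq_add (ext_hamming_wt_ge4 Hk1 k1N) (ext_hamming_wt_ge4 Hk2 k2N).
    by move=> /leq_trans /(_ wtk).
  (* Weight 3 is odd, so each extended period contains the parity position; if [q] is that position,
     any [p] will do. *)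
  have together q : exists k : word (option _),
      [/\ period (extend (mollard C D f)) k, (wt k <= 4)%N,
          k None = 1 & k q = 1].
    have [p pq] :
        exists p, if q is Some q' then mollard_period p q' = 1 else True.
      case: q => [q|]; first exact: mollard_period_cover.
      by exists (Ordinal t0, Ordinal m0).
    exists (extend_word (mollard_period p)); split.
    - exact/period_extend/mollard_periodP.
    - by rewrite wt_extend_word wt_mollard_period.
    - by rewrite ffunE sum_word wt_mollard_period.
    - by case: q pq => [q pq|_]; rewrite ffunE ?sum_word ?wt_mollard_period.
  (* The parity position is read from one half; position 0 of the other half serves as [q], so one
     light period meets both halves. *)
  case e: (s None) => [a|b].
    have [k [per k4 kN kq]] := together (s' (inr 0)).
    by case: (light k per k4) => [/(_ a)|/(_ 0)]; rewrite -?e ?sK ?kN ?kq.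
  have [k [per k4 kN kq]] := together (s' (inl 0)).
  by case: (light k per k4) => [/(_ 0)|/(_ b)]; rewrite -?e ?sK ?kN ?kq.
(* A period covering a position of the half indexed by all of F^r restricts there to a nonzero
   extended Hamming word, of weight at least 4, while the whole period has weight 3. *)
have [p pq] := mollard_period_cover (s' (inr 0)) t0 m0.
have := mollard_periodP C D f p.
rewrite eqC => /(period_equivalent sK s'K).
set k := [ffun q => _]; rewrite -(concatK k).
move=> /(period_soloveva tau_bij tau0 no_star) k2H.
have k2N : [ffun b => k (inr b)] != 0.
  by apply/eqP => /ffunP/(_ 0); rewrite ffunE /k ffunE pq ffunE.
have : wt k = 3 by rewrite wt_comp ?wt_mollard_period //; exists s.
rewrite -(concatK k) wt_concat => wtk.
have := leq_trans (ext_hamming_wt_ge4 k2H k2N)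
  (leq_addl (wt [ffun a => k (inl a)]) _).
by rewrite wtk.
Qed.
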